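(* Let $\mathfrak o$ be a Dedekind domain. The number of congruence subgroups of $\mathrm{SL}(2,\mathfrak o)$ containing the commutator subgroup of $\mathrm{SL}(2,\mathfrak o)$ is finite.
   Context: Fields are not considered Dedekind domains. For a nonzero ideal $\mathfrak l$ of $\mathfrak o$ let $\Gamma(\mathfrak l)$ be the kernel of the natural map $\mathrm{SL}(2,\mathfrak o)\to\mathrm{SL}(2,\mathfrak o/\mathfrak l)$. A subgroup of $\mathrm{SL}(2,\mathfrak o)$ is called a congruence subgroup if it contains $\Gamma(\mathfrak l)$ for some nonzero ideal $\mathfrak l$. *)

(* Defs.v *)
From HB Require Import structures.
From mathcomp Require Import all_boot all_order all_algebra ring_quotient.
From mathcomp Require Import boolp classical_sets functions cardinality.
Set Implicit Arguments.
Unset Strict Implicit.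
Unset Printing Implicit Defensive.
Import GRing.Theory.
Local Open Scope classical_set_scope.
Local Open Scope ring_scope.

(* Unlike [idealr] of ring_quotient, ideals are not required to be proper. *)
Record ideal (R : comPzRingType) := Ideal {
  ideal_set :> set R;
  ideal0 : ideal_set 0;
  idealD : forall x y, ideal_set x -> ideal_set y -> ideal_set (x + y);
  idealM : forall a x, ideal_set x -> ideal_set (a * x)
}.

Identity Coercion set_to_fun : set >-> Funclass.

Definition prime_ideal (R : comPzRingType) (P : ideal R) : Prop :=
  ~ P 1 /\ forall x y, P (x * y) -> P x \/ P y.

Definition maximal_ideal (R : comPzRingType) (M : ideal R) : Prop :=
  ~ M 1 /\ forall J : ideal R, M `<=` J -> J 1 \/ J `<=` M.

Definition nonzero_ideal (R : comPzRingType) (I : ideal R) : Prop :=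
  exists2 x, I x & x <> 0.

Definition noetherian (R : comPzRingType) : Prop :=
  forall I : ideal R, exists (n : nat) (g : 'I_n -> R),
    ideal_set I = [set x | exists c : 'I_n -> R, x = \sum_i c i * g i].

Definition integrally_closed (R : idomainType) : Prop :=
  forall z : {fraction R},
    integralOver (@tofrac R) z -> exists x : R, z = tofrac x.

Definition dedekind_domain (R : idomainType) : Prop :=
  [/\ ~ (forall x : R, x <> 0 -> x \is a GRing.unit),
      noetherian R,
      integrally_closed R
    & forall P : ideal R, prime_ideal P -> nonzero_ideal P -> maximal_ideal P].

Section IdealQuotient.
Variables (R : comPzRingType) (I : ideal R).

Definition ideal_pred : R -> bool := fun x => `[< I x >].

Fact ideal_pred_zmod_closed : zmod_closed ideal_pred.
Proof.
split=> [|x y /asboolP Ix /asboolP Iy]; apply/asboolP; first exact: ideal0.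
by apply: idealD => //; rewrite -mulN1r; apply: idealM.
Qed.
HB.instance Definition _ :=
  GRing.isZmodClosed.Build R ideal_pred ideal_pred_zmod_closed.

Definition ideal_zmodClosed : zmodClosed R :=
  GRing.ZmodClosed.clone R ideal_pred _.

(* The library makes a quotient a ring only when the ideal is proper; here the
   zero ring R / R is allowed, whence comPzRingType. *)
Definition ideal_quotient := Quotient.quot ideal_zmodClosed.
HB.instance Definition _ := GRing.Zmodule.on ideal_quotient.

Definition quot_pi : R -> ideal_quotient := \pi_(Quotient.quot ideal_zmodClosed)%qT.

Lemma quot_piP x y : quot_pi x = quot_pi y <-> I (x - y).
Proof.
split=> [/eqP|Ixy]; first by rewrite -Quotient.idealrBE => /asboolP.
by apply/eqP; rewrite -Quotient.idealrBE; apply/asboolP.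
Qed.

Definition quot_one : ideal_quotient := quot_pi 1.
Definition quot_mul (u v : ideal_quotient) : ideal_quotient :=
  quot_pi (repr u * repr v).

Lemma quot_piM : {morph quot_pi : x y / x * y >-> quot_mul x y}.
Proof.
move=> x y; apply/quot_piP.
have Irep z : I (z - repr (quot_pi z)) by apply/quot_piP; rewrite /quot_pi reprK.
set x' := repr (quot_pi x); set y' := repr (quot_pi y).
have -> : x * y - x' * y' = y * (x - x') + x' * (y - y').
  by rewrite !mulrBr (mulrC y x) (mulrC y x') addrA subrK.
by apply: idealD; apply: idealM; apply: Irep.
Qed.

Let piK (u : ideal_quotient) : quot_pi (repr u) = u.
Proof. exact: reprK. Qed.
Let piD : {morph quot_pi : x y / x + y}.
Proof. by move=> x y; rewrite /quot_pi raddfD. Qed.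

Fact quot_mulA : associative quot_mul.
Proof.
by move=> u v w; rewrite -(piK u) -(piK v) -(piK w) -!quot_piM mulrA.
Qed.
Fact quot_mulC : commutative quot_mul.
Proof. by move=> u v; rewrite -(piK u) -(piK v) -!quot_piM mulrC. Qed.
Fact quot_mul1 : left_id quot_one quot_mul.
Proof. by move=> u; rewrite -(piK u) -quot_piM mul1r. Qed.
Fact quot_mulDl : left_distributive quot_mul +%R.
Proof.
move=> u v w; rewrite -(piK u) -(piK v) -(piK w).
by rewrite -piD -!quot_piM mulrDl piD.
Qed.
HB.instance Definition _ := GRing.Zmodule_isComPzRing.Build ideal_quotient
  quot_mulA quot_mulC quot_mul1 quot_mulDl.

Fact quot_pi_zmod_morphism : zmod_morphism quot_pi.
Proof. by move=> x y; rewrite /quot_pi raddfB. Qed.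
Fact quot_pi_monoid_morphism : monoid_morphism quot_pi.
Proof. by split; last exact: quot_piM. Qed.
HB.instance Definition _ :=
  GRing.isZmodMorphism.Build R ideal_quotient quot_pi quot_pi_zmod_morphism.
HB.instance Definition _ :=
  GRing.isMonoidMorphism.Build R ideal_quotient quot_pi quot_pi_monoid_morphism.

End IdealQuotient.

Section SpecialLinear.
Variables (n : nat) (R : comPzRingType).

Record SL := MkSL { SL_mx :> 'M[R]_n; _ : \det SL_mx == 1 }.
HB.instance Definition _ := [isSub for SL_mx].
HB.instance Definition _ := [Choice of SL by <:].

Lemma det_SL (A : SL) : \det A = 1.
Proof. by case: A => A /= /eqP. Qed.

Fact SL_one_subproof : \det (1%:M : 'M[R]_n) == 1.
Proof. by rewrite det1. Qed.
Fact SL_mul_subproof (A B : SL) : \det (A *m B) == 1.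
Proof. by rewrite det_mulmx !det_SL mulr1. Qed.
Fact SL_inv_subproof (A : SL) : \det (\adj A) == 1.
Proof.
have: \det (A *m \adj A) = 1 by rewrite mul_mx_adj det_SL det1.
by rewrite det_mulmx det_SL mul1r => ->.
Qed.

Definition SL_one := MkSL SL_one_subproof.
Definition SL_mul A B := MkSL (SL_mul_subproof A B).
Definition SL_inv A := MkSL (SL_inv_subproof A).

Fact SL_mulA : associative SL_mul.
Proof. by move=> A B C; apply: val_inj; rewrite /= mulmxA. Qed.
Fact SL_mul1 : left_id SL_one SL_mul.
Proof. by move=> A; apply: val_inj; rewrite /= mul1mx. Qed.
Fact SL_mulr1 : right_id SL_one SL_mul.
Proof. by move=> A; apply: val_inj; rewrite /= mulmx1. Qed.
Fact SL_mulV : left_inverse SL_one SL_inv SL_mul.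
Proof. by move=> A; apply: val_inj; rewrite /= mul_adj_mx det_SL. Qed.
Fact SL_mulrV : right_inverse SL_one SL_inv SL_mul.
Proof. by move=> A; apply: val_inj; rewrite /= mul_mx_adj det_SL. Qed.
HB.instance Definition _ := isGroup.Build SL
  SL_mulA SL_mul1 SL_mulr1 SL_mulV SL_mulrV.

End SpecialLinear.

Section MapSL.
Variables (n : nat) (R S : comPzRingType) (f : {rmorphism R -> S}).

Fact map_SL_subproof (A : SL n R) : \det (map_mx f A) == 1.
Proof. by rewrite det_map_mx det_SL rmorph1. Qed.
Definition map_SL (A : SL n R) : SL n S := MkSL (map_SL_subproof A).

Lemma map_SL_is_morphism : {morph map_SL : A B / (A * B)%g}.
Proof. by move=> A B; apply: val_inj; rewrite /= map_mxM. Qed.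

End MapSL.

Definition Gamma (R : comPzRingType) (I : ideal R) : set (SL 2 R) :=
  [set A | map_SL (@quot_pi R I) A = 1%g].

Lemma GammaP (R : comPzRingType) (I : ideal R) (A : SL 2 R) :
  Gamma I A <-> forall i j, I (SL_mx A i j - (i == j)%:R).
Proof.
split=> [/(congr1 val)/matrixP AI i j|AI].
  by apply/quot_piP; have := AI i j; rewrite !mxE => ->; rewrite rmorph_nat.
apply/val_inj/matrixP => i j; rewrite !mxE.
by rewrite -[RHS](rmorph_nat (@quot_pi R I)); apply/quot_piP/AI.
Qed.

Definition subgroup (G : groupType) (H : set G) : Prop :=
  [/\ H 1%g, forall x y, H x -> H y -> H (x * y)%g
    & forall x, H x -> H (x^-1)%g].

Definition commutator_subgroup (G : groupType) : set G :=
  [set x | forall H : set G, subgroup H -> (forall a b : G, H [~ a, b]%g) -> H x].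
Arguments commutator_subgroup : clear implicits.

Definition congruence_subgroup (R : comPzRingType) (H : set (SL 2 R)) : Prop :=
  subgroup H /\ exists2 I : ideal R, nonzero_ideal I & Gamma I `<=` H.

(* Main.v *)
Require Import Defs.
From mathcomp Require Import all_boot all_order all_algebra ring.
From mathcomp Require Import boolp classical_sets functions cardinality.
Set Implicit Arguments.
Unset Strict Implicit.
Unset Printing Implicit Defensive.
Import GRing.Theory.
Local Open Scope classical_set_scope.
Local Open Scope ring_scope.

(* Let H contain the commutator subgroup and Gamma(I). Modulo I, where R/I has
   stable range one, every matrix is a product of elementary ones, and the lower
   elementary matrices are conjugate to upper ones; hence H is determined by the
   additive group J of the x with upper x in H. Let K be the largest ideal
   contained in J. Commutators with matrices congruent to diag(u, 1/u) modulo I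
   show that u^2 = 1 modulo K for every unit u modulo I, and stable range one
   extends this to every unit modulo K. Writing t = x^3 - x, the elements
   1 + t, 1 + t^2 and 1 - t turn out to be units modulo K, so that t^2 + 2t and
   t^4 + 2t^2 lie in K and therefore so does t^3. Thus J contains the ideal q
   generated by all (x^3 - x)^3, which does not depend on H, and R/q is finite by
   noetherian induction since a domain with x^3 = x has at most three elements. *)

(** * Ideals, stable range one and finite quotients *)

Section Ideals.
Variable R : comNzRingType.
Implicit Types (I J : ideal R) (a b c u x y : R).

Lemma ideal_eqM I c m x : I m -> x = c * m -> I x.
Proof. by move=> Im ->; apply: idealM. Qed.

Lemma ideal_eqMM I c m c' m' x : I m -> I m' -> x = c * m + c' * m' -> I x.
Proof. by move=> Im Im' ->; apply: idealD; apply: idealM. Qed.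

Definition adjoin I c : ideal R.
Proof.
exists [set x | exists2 y, I y & exists r, x = y + r * c].
- by exists 0; [apply: ideal0 | exists 0; ring].
- move=> _ _ [y Iy [r ->]] [z Iz [s ->]]; exists (y + z); first exact: idealD.
  by exists (r + s); ring.
- move=> a _ [y Iy [r ->]]; exists (a * y); first exact: idealM.
  by exists (a * r); ring.
Defined.

Lemma sub_adjoin I c : I `<=` adjoin I c.
Proof. by move=> x Ix; exists x => //; exists 0; ring. Qed.

Lemma mem_adjoin I c : adjoin I c c.
Proof. by exists 0; [apply: ideal0 | exists 1; ring]. Qed.

Definition colon I c : ideal R.
Proof.
exists [set x | I (x * c)].
- by rewrite /= mul0r; apply: ideal0.
- by move=> x y /= Ix Iy; rewrite mulrDl; apply: idealD.
- by move=> a x /= Ix; rewrite -mulrA; apply: idealM.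
Defined.

Definition ideal_cap I J : ideal R.
Proof.
exists (I `&` J).
- by split; apply: ideal0.
- by move=> x y [? ?] [? ?]; split; apply: idealD.
- by move=> a x [? ?]; split; apply: idealM.
Defined.

Definition ideal_span (X : set R) : ideal R.
Proof.
exists [set x | forall J : ideal R, X `<=` J -> J x].
- by move=> J _; apply: ideal0.
- by move=> x y Xx Xy J XJ; apply: idealD; [apply: Xx | apply: Xy].
- by move=> a x Xx J XJ; apply: idealM; apply: Xx.
Defined.

Lemma prime_or_zero_divisors I :
  [\/ I 1, prime_ideal I | exists c d, [/\ ~ I c, ~ I d & I (c * d)]].
Proof.
have [I1|nI1] := pselect (I 1); first by constructor 1.
have [zd|nzd] := pselect (exists c d, [/\ ~ I c, ~ I d & I (c * d)]).
  by constructor 3.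
constructor 2; split=> // x y Ixy.
have [|nx] := pselect (I x); first by left.
have [|ny] := pselect (I y); first by right.
by case: nzd; exists x, y.
Qed.

(** Each counterexample has a strictly larger one; the union of the resulting chain is finitely
    generated, hence reached at a finite stage. *)
Lemma noetherian_ind (P : ideal R -> Prop) : noetherian R ->
  (forall I, (forall J, I `<=` J -> ~ (J `<=` I) -> P J) -> P I) ->
  forall I, P I.
Proof.
move=> noeth step I0; apply: contrapT => nPI0.
have /choice[F FP] : forall I, exists J,
    ~ P I -> [/\ I `<=` J, ~ (J `<=` I) & ~ P J].
  move=> I; have [PI|nPI] := pselect (P I); first by exists I.
  apply: contrapT => nJ; apply: nPI; apply: step => J sIJ nsJI.
  by apply: contrapT => nPJ; apply: nJ; exists J.
pose C n := iter n F I0.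
have nPC n : ~ P (C n) by elim: n => //= n /FP[].
have C_homo m n : (m <= n)%N -> C m `<=` C n.
  move=> /subnK <-; elim: (n - m)%N => //= k IHk; apply: subset_trans IHk _.
  by have [] := FP _ (nPC (k + m)%N).
have U0 : exists n, C n 0 by exists 0%N; apply: ideal0.
have UD x y : (exists n, C n x) -> (exists n, C n y) -> exists n, C n (x + y).
  move=> [m Cx] [n Cy]; exists (maxn m n); apply: idealD.
    exact: (C_homo _ _ (leq_maxl m n)).
  exact: (C_homo _ _ (leq_maxr m n)).
have UM a x : (exists n, C n x) -> exists n, C n (a * x).
  by move=> [n Cx]; exists n; apply: idealM.
pose U := @Ideal R [set x | exists n, C n x] U0 UD UM.
have [n [g Ug]] := noeth U.
have /choice[N NP] (i : 'I_n) : exists m, C m (g i).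
  suff: ideal_set U (g i) by [].
  rewrite Ug; exists (fun j => (j == i)%:R).
  by rewrite (bigD1 i) //= eqxx mul1r big1 ?addr0 // => j /negPf->; rewrite mul0r.
pose M := (\max_i N i)%N.
have [_ + _] := FP _ (nPC M); apply=> x Cx.
have : ideal_set U x by exists M.+1.
rewrite Ug => -[c ->]; elim/big_ind: _ => [|y z|i _].
- exact: ideal0.
- exact: idealD.
- by apply: idealM; apply: (C_homo (N i)); [apply: leq_bigmax | apply: NP].
Qed.

Definition unit_mod I u := exists v, I (u * v - 1).

(* Stable range one for the quotients of a ring of dimension at most one. *)
Lemma unit_mod_addM I a b : noetherian R ->
    (forall P : ideal R, prime_ideal P -> nonzero_ideal P -> maximal_ideal P) ->
    nonzero_ideal I -> (exists r s, I (r * a + s * b - 1)) ->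
  exists t, unit_mod I (a + t * b).
Proof.
move=> noeth dim1; move: I a b; apply: (noetherian_ind noeth) => I IH a b nzI [r [s Iab]].
have nzS J : I `<=` J -> nonzero_ideal J by case: nzI => x Ix ?; exists x; auto.
(* A prime [I] is maximal, so [t] is 1 or 0 according to whether [a] lies in [I]. For zero divisors
   [c] and [d], induction applies to [adjoin I c] and [adjoin I d]. *)
case: (prime_or_zero_divisors I) => [I1|prI|[c [d [nIc nId Icd]]]].
- exists 0, 0; apply: (ideal_eqM (c := -1) I1); ring.
- have [Ia|nIa] := pselect (I a).
    exists 1, s; apply: (ideal_eqMM (c := 1) (c' := s - r) Iab Ia); ring.
  have [_ /(_ _ (@sub_adjoin I a))[|saI]] := dim1 I prI nzI.
    case=> y Iy [v e]; exists 0, v; apply: (ideal_eqM (c := -1) Iy).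
    by rewrite (_ : y = 1 - v * a); [ring | rewrite e; ring].
  by case: nIa; apply: saI; apply: mem_adjoin.
have adj_gt e : ~ I e -> ~ (adjoin I e `<=` I).
  by move=> nIe sub; apply/nIe/sub/mem_adjoin.
have sIc : I `<=` adjoin I c := @sub_adjoin I c.
have sId : I `<=` adjoin I d := @sub_adjoin I d.
have [|t1 [v1 u1]] := IH _ sIc (adj_gt c nIc) a b (nzS _ sIc).
  by exists r, s; apply: sIc.
(* m lies in I + (c), so adding a multiple of m to t1 keeps the invertibility
   modulo I + (c). *)
pose m := (a + t1 * b) * v1 - 1.
have [|t2 [v2 u2]] :=
    IH _ sId (adj_gt d nId) (a + t1 * b) (m * b) (nzS _ sId).
  (* Since [(a + t1 * b) * v1 - m = 1], the combination collapses to [r * a + s * b]. *)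
  exists (r + (s - r * t1) * b * v1), (- (s - r * t1)); apply: sId.
  apply: (ideal_eqM (c := 1) Iab); rewrite /m; ring.
exists (t1 + t2 * m).
set u := a + _.
have : adjoin I c (u * v1 - 1).
  apply: (ideal_eqM (c := 1 + t2 * b * v1) u1); rewrite /u /m; ring.
have : adjoin I d (u * v2 - 1).
  by apply: (ideal_eqM (c := 1) u2); rewrite /u /m; ring.
case=> y2 Iy2 [r2 e2] [y1 Iy1 [r1 e1]].
(* For this [v], [1 - u * v = (1 - u * v1) * (1 - u * v2)], which lies in [I] because [c * d]
   does. *)
exists (v1 + v2 - u * v1 * v2).
have -> : u * (v1 + v2 - u * v1 * v2) - 1 = - ((u * v1 - 1) * (u * v2 - 1)).
  by ring.
rewrite e1 e2 (_ : - _ =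
  - (y2 + r2 * d) * y1 + (- (r1 * c) * y2 + - (r1 * r2) * (c * d))); last by ring.
by do !apply: idealD; apply: idealM.
Qed.

(** When [c * d] lies in [I], R/I is an extension of R/(I + (c)) by (I + (c))/I, which is isomorphic
    to R/(I : c); both ideals are strictly larger than [I]. *)
Lemma finite_index_of_cube I : noetherian R ->
    (forall x, I ((x ^+ 3 - x) ^+ 3)) ->
  exists s : seq R, forall x, exists2 y, y \in s & I (x - y).
Proof.
move=> noeth; move: I; apply: (noetherian_ind noeth) => I IH cubeI.
case: (prime_or_zero_divisors I) => [I1|[nI1 prI]|[c [d [nIc nId Icd]]]].
- exists [:: 0] => x; exists 0; rewrite ?inE //.
  by apply: (ideal_eqM (c := x) I1); ring.
- exists [:: 0; 1; -1] => x.
  have : I (x * ((x - 1) * (x + 1))).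
    have /prI : I ((x ^+ 3 - x) * ((x ^+ 3 - x) * (x ^+ 3 - x))).
      by apply: (ideal_eqM (c := 1) (cubeI x)); ring.
    rewrite (_ : x * _ = x ^+ 3 - x); last by ring.
    by case=> [//|/prI[]].
  case/prI => [Ix|/prI[Ix|Ix]].
  + by exists 0; rewrite ?inE ?eqxx // subr0.
  + by exists 1; rewrite ?inE ?eqxx ?orbT.
  + by exists (-1); rewrite ?inE ?eqxx ?orbT // opprK.
have [|s1 s1P] := IH _ (@sub_adjoin I c) (fun sub => nIc (sub _ (mem_adjoin I c))).
  by move=> x; apply: sub_adjoin.
have sIcol : I `<=` colon I c by move=> x Ix /=; rewrite mulrC; apply: idealM.
have [||s2 s2P] := IH _ sIcol.
- by move=> /(_ d); rewrite /= mulrC => /(_ Icd).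
- by move=> x; apply: sIcol.
exists [seq y + z * c | y <- s1, z <- s2] => x.
have [y ys1 [i Ii [r e]]] := s1P x; have [z zs2 Iz] := s2P r.
exists (y + z * c); first exact: allpairs_f.
have -> : x - (y + z * c) = i + (r - z) * c.
  by rewrite (_ : i = x - y - r * c); [ring | rewrite e; ring].
exact: idealD.
Qed.

End Ideals.

(** * Calculation in the abelian quotient by [H] *)

Section AbelianQuotient.
Variables (G : groupType) (H : set G).
Hypotheses (sgH : subgroup H) (sG'H : commutator_subgroup G `<=` H).
Implicit Types x y z : G.

Definition coset_eq x y := H (x * y^-1)%g.

Let H1 : H 1%g. Proof. by case: sgH. Qed.
Let HM x y : H x -> H y -> H (x * y)%g. Proof. by case: sgH => _ + _; apply. Qed.
Let HV x : H x -> H (x^-1)%g. Proof. by case: sgH => _ _; apply. Qed.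

Lemma mem_mulC x y : H (x * y)%g -> H (y * x)%g.
Proof.
move=> Hxy; rewrite commgC; apply: HM => //; apply: sG'H => K _; exact.
Qed.

Lemma coset_eq_refl x : coset_eq x x.
Proof. by rewrite /coset_eq mulgV. Qed.

Lemma coset_eq_sym x y : coset_eq x y -> coset_eq y x.
Proof. by move=> /HV; rewrite invgM invgK. Qed.

Lemma coset_eq_trans y x z : coset_eq x y -> coset_eq y z -> coset_eq x z.
Proof. by move=> xy /(HM xy); rewrite mulgA mulgVK. Qed.

Lemma coset_eqM x x' y y' :
  coset_eq x x' -> coset_eq y y' -> coset_eq (x * y) (x' * y').
Proof.
move=> xx' yy'; apply: mem_mulC; rewrite invgM mulgA; apply: mem_mulC.
have : H ((y * y'^-1) * (x'^-1 * x))%g by apply: HM => //; apply: mem_mulC.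
by rewrite !mulgA.
Qed.

Lemma coset_eqC x y : coset_eq (x * y) (y * x).
Proof.
rewrite /coset_eq (commgCV x y) mulgK; apply: sG'H => K _; exact.
Qed.

Lemma coset_eqMl z x y : coset_eq (z * x) (z * y) -> coset_eq x y.
Proof.
by move/(coset_eqM (coset_eq_refl z^-1)); rewrite !mulKg.
Qed.

Lemma mem_coset_eq x y : coset_eq x y -> H y -> H x.
Proof. by move=> xy /(HM xy); rewrite mulgVK. Qed.

End AbelianQuotient.

(** * Elementary matrices of size two *)

Section SL2.
Variable R : comNzRingType.
Implicit Types (a b c d u v x y : R) (A B : SL 2 R).

Lemma ord2_ind (P : 'I_2 -> Prop) : P 0 -> P 1 -> forall i, P i.
Proof.
move=> P0 P1 [[|[|//]] lt_i2].
  by rewrite (_ : Ordinal lt_i2 = 0) //; apply: val_inj.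
by rewrite (_ : Ordinal lt_i2 = 1) //; apply: val_inj.
Qed.

Lemma mulmx2E (A B : 'M[R]_2) i j :
  (A *m B) i j = A i 0 * B 0 j + A i 1 * B 1 j.
Proof.
rewrite mxE big_ord_recl big_ord1; congr (_ + A i _ * B _ j); exact: val_inj.
Qed.

Lemma det_mx2 (A : 'M[R]_2) : \det A = A 0 0 * A 1 1 - A 0 1 * A 1 0.
Proof.
rewrite (expand_det_row _ 0) big_ord_recl big_ord1 /cofactor !det_mx11 !mxE /=.
rewrite expr0 expr1 mul1r mulN1r mulrN.
by congr (_ * A _ _ - A _ _ * A _ _); apply: val_inj.
Qed.

Definition mx2 a b c d : 'M[R]_2 :=
  \matrix_(i, j) if i == 0 then if j == 0 then a else b
                 else if j == 0 then c else d.

Fact mk_SL2_subproof a b c d : a * d - b * c = 1 -> \det (mx2 a b c d) == 1.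
Proof. by move=> abcd; rewrite det_mx2 !mxE /= abcd. Qed.
Definition mk_SL2 a b c d (abcd : a * d - b * c = 1) :=
  MkSL (mk_SL2_subproof abcd).

Fact upper_subproof x : 1 * 1 - x * 0 = 1 :> R. Proof. by ring. Qed.
Definition upper x : SL 2 R := mk_SL2 (upper_subproof x).

Fact lower_subproof x : 1 * 1 - 0 * x = 1 :> R. Proof. by ring. Qed.
Definition lower x : SL 2 R := mk_SL2 (lower_subproof x).

Lemma SL2_eq A B : (forall i j, SL_mx A i j = SL_mx B i j) -> A = B.
Proof. by move=> AB; apply/val_inj/matrixP. Qed.

Lemma SL_mxM A B : SL_mx (A * B)%g = SL_mx A *m SL_mx B.
Proof. by []. Qed.

Lemma upperD x y : upper (x + y) = (upper x * upper y)%g.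
Proof.
by apply: SL2_eq; do 2!apply: ord2_ind; rewrite SL_mxM mulmx2E !mxE /=; ring.
Qed.

Lemma upper0 : upper 0 = 1%g.
Proof. by apply: SL2_eq; do 2!apply: ord2_ind; rewrite !mxE. Qed.

Lemma upperN x : upper (- x) = (upper x)^-1%g.
Proof. by apply: (mulgI (upper x)); rewrite -upperD subrr upper0 mulgV. Qed.

Lemma Gamma_congr (I : ideal R) A B :
  (forall i j, I (SL_mx A i j - SL_mx B i j)) -> Gamma I (A * B^-1)%g.
Proof.
move=> AB; rewrite /Gamma /= map_SL_is_morphism.
suff -> : map_SL (@quot_pi R I) A = map_SL (@quot_pi R I) B.
  by rewrite -map_SL_is_morphism mulgV; apply: val_inj; rewrite /= map_mx1.
by apply/val_inj/matrixP => i j; rewrite !mxE; apply/quot_piP.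
Qed.

End SL2.

(** * The ideal attached to a congruence subgroup *)

Section CongruenceSubgroup.
Variables (R : comNzRingType) (H : set (SL 2 R)).
Hypotheses (sgH : subgroup H) (sG'H : commutator_subgroup (SL 2 R) `<=` H).
Implicit Types (a b c d u v x y : R) (A B : SL 2 R).

(** Conjugation by the matrix with rows (0, 1) and (-1, 0) sends [lower x] to [upper (- x)], and
    conjugates agree modulo [H]. *)
Lemma lower_coset_eq x : coset_eq H (lower x) (upper (- x)).
Proof.
have w1 : 0 * 0 - 1 * (-1) = 1 :> R by ring.
apply: (coset_eqMl sgH sG'H (z := mk_SL2 w1)).
apply: (coset_eq_trans sgH _ (coset_eqC sG'H _ _)).
rewrite (_ : (_ * lower x = upper (- x) * mk_SL2 w1)%g); first exact: coset_eq_refl.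
by apply: SL2_eq; do 2!apply: ord2_ind; rewrite !SL_mxM !mulmx2E !mxE /=; ring.
Qed.

Variable I : ideal R.
Hypothesis sGH : Gamma I `<=` H.

Lemma upper_unit_mod u x : unit_mod I u -> H (upper ((u ^+ 2 - 1) * x)).
Proof.
case=> v; set m := u * v - 1 => Im.
(* A lift of diag(u, 1/u) modulo [I]: as [u * v = 1 + m], the determinant is (1 + m)(1 - m) + m^2.
   Conjugating [upper x] by it multiplies [x] by u^2 modulo [I]. *)
have D1 : u * (v * (1 - m)) - m * (- m) = 1 by rewrite /m; ring.
pose D := mk_SL2 D1.
suff : coset_eq H (upper (u ^+ 2 * x)) (upper x).
  by rewrite /coset_eq -upperN -upperD mulrBl mul1r.
apply: (coset_eqMl sgH sG'H (z := D)).
apply: (coset_eq_trans sgH (coset_eqC sG'H _ _)).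
apply: sGH; apply: Gamma_congr; do 2!apply: ord2_ind;
  rewrite !SL_mxM !mulmx2E !mxE /=.
- by apply: (ideal_eqM (c := - (u ^+ 2 * x)) Im); ring.
- by apply: (ideal_eqM (c := - (u * x) * m) Im); rewrite /m; ring.
- by apply: (ideal_eqM (c := 0) Im); ring.
- by apply: (ideal_eqM (c := x) Im); ring.
Qed.

(** The ideal K of the overview: every ideal that [upper] maps into [H] lies in it. *)
Definition upper_ideal : ideal R.
Proof.
exists [set y | forall r, H (upper (r * y))].
- by move=> r; rewrite mulr0 upper0; case: sgH.
- move=> x y Hx Hy r; rewrite mulrDr upperD.
  by case: sgH => _ + _; apply; [apply: Hx | apply: Hy].
- by move=> a x Hx r; rewrite mulrA; apply: Hx.
Defined.

Lemma sub_upper_ideal : I `<=` upper_ideal.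
Proof.
move=> x Ix r; apply: sGH; apply/GammaP.
do 2!apply: ord2_ind; rewrite !mxE /= ?subrr ?subr0; try exact: ideal0.
exact: idealM.
Qed.

Hypothesis noeth : noetherian R.
Hypothesis dim1 :
  forall P : ideal R, prime_ideal P -> nonzero_ideal P -> maximal_ideal P.
Hypothesis nzI : nonzero_ideal I.

(** Stable range one moves [u] by a multiple of [u * v - 1], hence within its class modulo K, to a
    unit modulo [I]. *)
Lemma upper_ideal_sqr u : unit_mod upper_ideal u -> upper_ideal (u ^+ 2 - 1).
Proof.
case=> v; set k := u * v - 1 => Kk.
have [|t /upper_unit_mod Ht] := @unit_mod_addM _ I u k noeth dim1 nzI.
  by exists v, (-1); rewrite (_ : _ - 1 = 0); [apply: ideal0 | rewrite /k; ring].
have Kt : upper_ideal ((u + t * k) ^+ 2 - 1).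
  by move=> r; rewrite mulrC; apply: Ht.
apply: (ideal_eqMM (c := 1) (c' := - (2 * u * t + t ^+ 2 * k)) Kt Kk); ring.
Qed.

(** Let c be the claimed unit. Some x + t c is a unit modulo [I], so x^2 = 1 modulo K + (c); then
    x^3 - x vanishes there and c = 1, so K + (c) is the whole ring. *)
Lemma unit_mod_upper_ideal x r : unit_mod upper_ideal (1 + r * (x ^+ 3 - x)).
Proof.
set c := 1 + _.
have [|t /upper_unit_mod Ht] := @unit_mod_addM _ I x c noeth dim1 nzI.
  by exists (- r * (x ^+ 2 - 1)), 1; rewrite (_ : _ - 1 = 0);
    [apply: ideal0 | rewrite /c; ring].
have Kt : upper_ideal ((x + t * c) ^+ 2 - 1).
  by move=> s; rewrite mulrC; apply: Ht.
(* e is chosen so that x^2 - 1 = - e c modulo K; as c = 1 + r x (x^2 - 1),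
   this gives c (1 + r x e) = 1 modulo K. *)
pose e := 2 * x * t + t ^+ 2 * c.
exists (1 + r * x * e).
apply: (ideal_eqM (c := r * x) Kt); rewrite /e /c; ring.
Qed.

Lemma upper_ideal_cube x : upper_ideal ((x ^+ 3 - x) ^+ 3).
Proof.
set t := x ^+ 3 - x; have unit_t r := upper_ideal_sqr (unit_mod_upper_ideal x r).
have K1 := unit_t 1; have Kt := unit_t t.
have [v Kv] := unit_mod_upper_ideal x (-1).
(* This is t (t^2 + 2t) - (t^4 + 2t^2); the factor 1 - t is then cancelled by its inverse [v] modulo
   K. *)
have Kt34 : upper_ideal (t ^+ 3 * (1 - t)).
  apply: (ideal_eqMM (c := t) (c' := - 1) K1 Kt); rewrite -/t; ring.
apply: (ideal_eqMM (c := v) (c' := - t ^+ 3) Kt34 Kv); rewrite -/t; ring.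
Qed.

End CongruenceSubgroup.

(** Choosing [s] before [H] lets one [s] serve two subgroups at once. *)
Lemma SL2_coset_upper (R : comNzRingType) (I : ideal R) (A : SL 2 R) :
    noetherian R ->
    (forall P : ideal R, prime_ideal P -> nonzero_ideal P -> maximal_ideal P) ->
    nonzero_ideal I ->
  exists s, forall H : set (SL 2 R), subgroup H ->
    commutator_subgroup (SL 2 R) `<=` H -> Gamma I `<=` H ->
    coset_eq H A (upper s).
Proof.
move=> noeth dim1 nzI.
pose a := SL_mx A 0 0; pose b := SL_mx A 0 1.
pose c := SL_mx A 1 0; pose d := SL_mx A 1 1.
have detA : a * d - b * c = 1 by rewrite -det_mx2 det_SL.
have [|t [v]] := @unit_mod_addM _ I a c noeth dim1 nzI.
  exists d, (- b); rewrite (_ : _ - 1 = 0); first exact: ideal0.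
  by rewrite -detA; ring.
set u := a + t * c; set m := u * v - 1 => Im.
(* Row operations modulo [I]: [upper t] makes the corner the unit [u], [lower w] puts 1 below it,
   [upper (1 - u)] turns the corner into 1 and [lower (-1)] clears the column, leaving [upper y]. *)
pose b' := b + t * d; pose w := v * (1 - c).
pose y := b' + (1 - u) * (d + w * b').
(* The subtracted sum collects the four row operations, each [lower x] counting as [upper (- x)]. *)
exists (y - (1 + (1 - u) - w + t)) => H sgH sG'H sGH.
apply: (coset_eqMl sgH sG'H (z := upper (1 + (1 - u) - w + t))).
rewrite -upperD subrKC.
pose X := (lower (-1) * upper (1 - u) * lower w * upper t * A)%g.
have XE : coset_eq H X (upper y).
  have det' : u * d - b' * c = 1 by rewrite -detA /u /b'; ring.
  have dE : u * d = 1 + b' * c by rewrite -det'; ring.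
  apply: sGH; apply: Gamma_congr; do 2!apply: ord2_ind;
    rewrite !SL_mxM !mulmx2E !mxE /= -/a -/b -/c -/d.
  - apply: (ideal_eqM (c := (1 - u) * (1 - c)) Im).
    by rewrite /m /w /u; ring.
  - by apply: (ideal_eqM (c := 0) Im); rewrite /y /b' /w /u; ring.
  - by apply: (ideal_eqM (c := u * (1 - c)) Im); rewrite /m /w /u; ring.
  - apply: (ideal_eqM (c := (1 - c) * b') Im).
    rewrite (_ : (_ - 1 = u * d + w * u * b' - b' - 1)); last first.
      by rewrite /b' /u; ring.
    by rewrite dE /m /w; ring.
apply: (coset_eq_trans sgH _ XE); apply: coset_eqM => //; last exact: coset_eq_refl.
apply: coset_eq_sym => //; rewrite !upperD.
have refl B : coset_eq H B B by apply: coset_eq_refl.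
apply: (coset_eqM sgH sG'H _ (refl _)).
apply: (coset_eqM sgH sG'H _ (lower_coset_eq sgH sG'H w)).
apply: (coset_eqM sgH sG'H _ (refl _)).
by rewrite -{2}(opprK 1); apply: lower_coset_eq.
Qed.

Theorem corollary1 (R : idomainType) (hR : dedekind_domain R) :
  finite_set [set H : set (SL 2 R) |
    congruence_subgroup H /\ commutator_subgroup (SL 2 R) `<=` H].
Proof.
have [_ noeth _ dim1] := hR.
set S := [set H | _].
pose q := ideal_span [set y : R | exists x, y = (x ^+ 3 - x) ^+ 3].
have qcube x : q ((x ^+ 3 - x) ^+ 3) by move=> J; apply; exists x.
have qmin H x : S H -> q x -> H (upper x).
  move=> [[sgH [I nzI sGH]] sG'H] /(_ (upper_ideal sgH)) Kx.
  rewrite -[x]mul1r; apply: Kx => _ [y ->].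
  exact: (upper_ideal_cube sgH sG'H sGH).
have [s sP] := finite_index_of_cube noeth qcube.
(* Each [H] in [S] contains [upper x] for all [x] in [q], so the representatives [s] of R/q decide
   every membership [H (upper z)]. *)
pose f (H : set (SL 2 R)) : {set 'I_(size s)} :=
  [set i | `[< H (upper (tnth (in_tuple s) i)) >]]%SET.
have f_eq H1 H2 : S H1 -> S H2 -> f H1 = f H2 -> H1 `<=` H2.
  move=> SH1 SH2 f12 A H1A.
  have [[sg1 [I1 [x1 I1x nz1] sG1]] sG'1] := SH1.
  have [[sg2 [I2 [x2 I2x nz2] sG2]] sG'2] := SH2.
  (* A common level, nonzero since [R] is a domain, gives one [upper z] representing [A] modulo both
     subgroups. *)
  pose I := ideal_cap I1 I2.
  have nzI : nonzero_ideal I.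
    exists (x1 * x2); first by split; [rewrite mulrC|]; apply: idealM.
    by apply/eqP; rewrite mulf_neq0 //; apply/eqP.
  have sG J H : Gamma J `<=` H -> I `<=` J -> Gamma I `<=` H.
    by move=> sGJ sIJ B /GammaP GB; apply: sGJ; apply/GammaP => i j; apply: sIJ.
  have [z zP] := SL2_coset_upper A noeth dim1 nzI.
  have A1 := zP _ sg1 sG'1 (sG _ _ sG1 (@subIsetl _ _ _)).
  have A2 := zP _ sg2 sG'2 (sG _ _ sG2 (@subIsetr _ _ _)).
  apply: (mem_coset_eq sg2 A2).
  have H1z := mem_coset_eq sg1 (coset_eq_sym sg1 A1) H1A.
  have [y ys qzy] := sP z.
  have zy H : S H -> coset_eq H (upper z) (upper y).
    by move=> SH; rewrite /coset_eq -upperN -upperD; apply: qmin.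
  apply: (mem_coset_eq sg2 (zy _ SH2)).
  have := mem_coset_eq sg1 (coset_eq_sym sg1 (zy _ SH1)) H1z.
  have /tnthP[i ->] : y \in in_tuple s by [].
  move=> H1i; have : i \in f H1 by rewrite inE; apply/asboolP.
  by rewrite f12 inE => /asboolP.
have f_inj : {in S &, injective f}.
  move=> H1 H2 /set_mem SH1 /set_mem SH2 f12.
  by apply/seteqP; split; apply: f_eq.
by rewrite -(eq_finite_set (inj_card_eq f_inj)); apply: finite_finset.
Qed.
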